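(* Let $V$ be a 3-dimensional complex vector space with a Hermitian form $h$ of signature $(2,1)$. Let $z,w\in V$ be non-null vectors (i.e. $h(z,z)\neq 0$ and $h(w,w)\ne 0$), put $a=h(z,z)$, $\Delta_H(z,w)=h(z,z)h(w,w)-|h(z,w)|^2$, and set $$v=a\,w-h(w,z)\,z .$$ Then $$h(v,v)=a\,\Delta_H(z,w).$$ Consequently, if $\Delta_H(z,w)=0$, then $h(v,v)=0$. If moreover $[z]\neq[w]$ in $\mathbb P(V)$, then $v\neq 0$, so that $[v]$ is a point of $\partial\mathbb{C}\mathrm{H}^2$ lying on the projective join of $[z]$ and $[w]$ (the projectivization of $\operatorname{span}\{z,w\}$). Equivalently to this nonvanishing: for non-null $z,w$, if $v=0$ then $[z]=[w]$.
   Context: $h$ is linear in the first argument and conjugate-linear in the second: $h(\lambda z,\mu w)=\lambda\overline{\mu}\,h(z,w)$. For nonzero $z\in V$, $[z]$ is the complex line through $z$, a point of $\mathbb P(V)$. $V_0=\{z\neq 0: h(z,z)=0\}$ and $\partial\mathbb{C}\mathrm{H}^2=\mathbb P(V_0)$ is the set of null lines. *)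

(* Defs.v *)
From HB Require Import structures.
From mathcomp Require Import all_boot all_order all_algebra.
From mathcomp Require Import sesquilinear complex.
From mathcomp Require Import classical_sets reals.

Set Implicit Arguments.
Unset Strict Implicit.
Unset Printing Implicit Defensive.

Import Order.TTheory GRing.Theory Num.Theory.
Local Open Scope classical_set_scope.
Local Open Scope ring_scope.

Section Projective.
Variables (R : realType) (V : vectType R[i]).
(* In sesquilinear.v, [{hermitian V for eps & theta}] is linear in the first
   argument and [theta]-linear in the second; [eps = false] means
   h x y = theta (h y x). *)
Implicit Types (h : {hermitian V for false & (@Num.conj R[i])}) (z w : V).

(* The order on R[i] is partial: 0 < x forces x to be real, which is always
   the case for x = h e e. *)
Definition has_signature h (p q : nat) : Prop :=
  exists e : (p + q).-tuple V,
    [/\ basis_of fullv e,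
        forall i j : 'I_(p + q), i != j -> h e`_i e`_j = 0,
        forall i : 'I_(p + q), (i < p)%N -> 0 < h e`_i e`_i
      & forall i : 'I_(p + q), (p <= i)%N -> h e`_i e`_i < 0].

(* `|_| on R[i] takes its values in R[i]. *)
Definition DeltaH h z w : R[i] := h z z * h w w - `|h z w| ^+ 2.

Definition nonnull h z : Prop := h z z != 0.

(* For z != 0, the point [z] of P(V) is the line <[z]>%VS; projectivization A
   is the set of the points [z] for z nonzero in A. *)
Definition projectivization (A : set V) : set {vspace V} :=
  [set <[z]>%VS | z in [set z | A z /\ z != 0]].

Definition null_vectors h : set V := [set z | z != 0 /\ h z z = 0].

Definition boundary h : set {vspace V} := projectivization (null_vectors h).

Definition projective_join z w : set {vspace V} :=
  projectivization [set x | x \in (<<[:: z; w]>>)%VS].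

End Projective.

(* Main.v *)
Require Import Defs.
From HB Require Import structures.
From mathcomp Require Import all_boot all_order all_algebra.
From mathcomp Require Import sesquilinear complex.
From mathcomp Require Import classical_sets reals.
From mathcomp Require Import ring.

Set Implicit Arguments.
Unset Strict Implicit.
Unset Printing Implicit Defensive.

Import Order.TTheory GRing.Theory Num.Theory.
Local Open Scope ring_scope.

(** The vector [v] is [a] times the component of [w] orthogonal to [z]: indeed h(v,z) = a h(w,z) -
    h(w,z) a = 0. As [a] is real, h(v,v) = a h(v,w) = a (a h(w,w) - |h(z,w)|^2), which
    [hnorm_residual] gets by direct expansion. The projective claims rest on [residual_eq0_vline]: a
    vanishing [v] is a linear relation making [z] and [w] proportional. *)

Lemma hnorm_residual (R : realType) (V : vectType R[i])
    (h : {hermitian V for false & (@Num.conj R[i])}) (z w : V) :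
  let v := h z z *: w - h w z *: z in h v v = h z z * DeltaH h z w.
Proof.
move=> v; have hC x y : h x y = (h y x)^* by rewrite (hermC h) expr0 mul1r.
rewrite /v /DeltaH linearBl !linearBr !linearZl_LR !linearZr_LR /=.
(* Hermitian symmetry removes every conjugate: [h z z] is self-conjugate and the squared modulus
   becomes [h z w * h w z], so a commutative ring identity remains. *)
rewrite -[(h z z)^*]hC -[(h w z)^*]hC normCK -[(h z w)^*]hC.
ring.
Qed.

(** Dividing by [a] gives w = (b/a) z; since [w] is nonzero, so is b/a, and the relation can be
    inverted. Each vector then lies on the line of the other. *)
Lemma residual_eq0_vline (K : fieldType) (V : vectType K) (a b : K)
    (z w : V) :
  a != 0 -> w != 0 -> a *: w - b *: z = 0 -> <[z]>%VS = <[w]>%VS.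
Proof.
move=> a0 w0 /subr0_eq awE.
have wE : w = (a^-1 * b) *: z by rewrite -scalerA -awE scalerK.
have c0 : a^-1 * b != 0.
  by apply: contraNneq w0 => c0; rewrite wE c0 scale0r.
have zE : z = (a^-1 * b)^-1 *: w by rewrite wE scalerK.
apply/eqP; rewrite eqEsubv -!memvE; apply/andP.
by split; apply/vlineP; [exists (a^-1 * b)^-1 | exists (a^-1 * b)].
Qed.

Theorem proposition4p5 (R : realType) (V : vectType R[i])
    (dimV : \dim {:V} = 3%N)
    (h : {hermitian V for false & (@Num.conj R[i])})
    (sign_h : has_signature h 2 1)
    (z w : V) (hz : nonnull h z) (hw : nonnull h w) :
  let a := h z z in
  let v := a *: w - h w z *: z in
  [/\ h v v = a * DeltaH h z w,
      DeltaH h z w = 0 -> h v v = 0,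
      DeltaH h z w = 0 -> <[z]>%VS <> <[w]>%VS ->
        [/\ v <> 0, boundary h <[v]>%VS & projective_join z w <[v]>%VS],
      <[z]>%VS <> <[w]>%VS -> v <> 0
    & v = 0 -> <[z]>%VS = <[w]>%VS].
Proof.
move=> a v.
have w0 : w != 0 by apply: contraNneq hw => ->; rewrite linear0l.
have hv : h v v = a * DeltaH h z w := hnorm_residual h z w.
(* Non-nullity of [z] is exactly [a != 0]; that of [w] serves through [w != 0]. *)
have v0_line : v = 0 -> <[z]>%VS = <[w]>%VS := residual_eq0_vline hz w0.
have v_null : DeltaH h z w = 0 -> h v v = 0 by move=> D0; rewrite hv D0 mulr0.
have v_neq0 : <[z]>%VS <> <[w]>%VS -> v <> 0 by move=> zw /v0_line.
split=> // D0 zw; have /eqP v0 := v_neq0 zw.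
split; first exact/eqP.
  (* In both memberships [v] itself represents its line. *)
  by exists v => //=; split=> //; split=> //; exact: v_null.
exists v => //=; split=> //.
by rewrite rpredB // rpredZ // memv_span // !inE eqxx ?orbT.
Qed.
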